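(* For every integer $N\ge 2$, the set $W_N\subset\mathbb R^{N-1}$ is homeomorphic to the closed unit ball $B^{N-1}=\{\mathbf x\in\mathbb R^{N-1}:\|\mathbf x\|\le 1\}$.
   Context: Let $N\ge 2$ be an integer and $\mathbb T=\{z\in\mathbb C:|z|=1\}$. For $\mathbf a=(a_1,\dots,a_{N-1})\in\mathbb R^{N-1}$ define $\mathbf c=(c_1,\dots,c_{N-1})\in\mathbb C^{N-1}$ by $c_j=\frac{\sqrt2}{2}(a_j+i\,a_{N-j})$ for $1\le j<N/2$, $c_{N/2}=a_{N/2}$ (only when $N$ is even), and $c_j=\frac{\sqrt2}{2}(a_{N-j}-i\,a_j)$ for $N/2<j\le N-1$ (so $c_{N-j}=\overline{c_j}$ and $\|\mathbf c\|=\|\mathbf a\|$). Associate to $\mathbf a$ the monic polynomial $\mathbf a(x)=x^N+\sum_{n=1}^{N-1}c_nx^{N-n}+1$. Define $W_N=\{\mathbf a\in\mathbb R^{N-1}:\text{all roots of }\mathbf a(x)\text{ lie in }\mathbb T\}$, with the subspace topology and Euclidean metric from $\mathbb R^{N-1}$. *)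

(* Defs.v *)
From HB Require Import structures.
From mathcomp Require Import all_boot all_order all_algebra.
From mathcomp Require Import all_classical all_reals all_analysis.
From mathcomp Require Import complex.
Set Implicit Arguments. Unset Strict Implicit. Unset Printing Implicit Defensive.
Import Order.TTheory GRing.Theory Num.Theory.
Import numFieldNormedType.Exports.
Local Open Scope classical_set_scope.
Local Open Scope ring_scope.
Local Open Scope complex_scope.

Section W.
Variable R : realType.
Variable N : nat.

(* a : 'rV[R]_(N.-1) ; the paper's a_j (1 <= j <= N-1) is a 0 (j-1). *)
Definition acoef (a : 'rV[R]_(N.-1)) (j : nat) : R :=
  match @insub nat (fun k => (k < N.-1)%N) 'I_(N.-1) j.-1 with
  | Some k => a 0 k | None => 0 end.

Definition ccoef (a : 'rV[R]_(N.-1)) (j : nat) : R[i] :=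
  if (j.*2 < N)%N then
    ((Num.sqrt 2 / 2)%:C * ((acoef a j)%:C + 'i * (acoef a (N - j))%:C))
  else if j.*2 == N then (acoef a j)%:C
  else ((Num.sqrt 2 / 2)%:C * ((acoef a (N - j))%:C - 'i * (acoef a j)%:C)).

Definition apoly (a : 'rV[R]_(N.-1)) : {poly R[i]} :=
  'X^N + \sum_(1 <= n < N) (ccoef a n)%:P * 'X^(N - n) + 1.

Definition W : set 'rV[R]_(N.-1) :=
  [set a | forall z : R[i], root (apoly a) z -> `|z| = 1].

Definition closed_unit_ball : set 'rV[R]_(N.-1) :=
  [set x | \sum_(k < N.-1) (x 0 k) ^+ 2 <= 1].

End W.

Definition homeomorphic_subspaces (T : topologicalType) (A B : set T) : Prop :=
  exists (f g : T -> T),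
    {within A, continuous f} /\ {within B, continuous g} /\
    (forall x, A x -> B (f x)) /\ (forall y, B y -> A (g y)) /\
    (forall x, A x -> g (f x) = x) /\ (forall y, B y -> f (g y) = y).

(* Main.v *)
Require Import Defs.
From HB Require Import structures.
From mathcomp Require Import all_boot all_order all_algebra.
From mathcomp Require Import all_classical all_reals all_analysis.
From mathcomp Require Import complex.
From mathcomp Require Import ring lra zify.
Import numFieldNormedType.Exports.

Set Implicit Arguments. Unset Strict Implicit. Unset Printing Implicit Defensive.
Import Order.TTheory GRing.Theory Num.Theory.
Local Open Scope classical_set_scope.
Local Open Scope ring_scope.

(** Write the roots as [- expi (phi k)]. As their product is fixed, the real
    angles [phi 0 <= .. <= phi n <= phi 0 + 2 pi] can be chosen with sum [0]
    (passing from [phi 0, .., phi n] to [phi 1, .., phi n, phi 0 + 2 pi] adds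
    [2 pi] to the sum), and they are then determined by the polynomial. So [W]
    is the continuous bijective image of the simplex of the gaps
    [phi k.+1 - phi k], which a radial map identifies with the ball;
    compactness of the ball makes the inverse continuous. *)

(** * Angles on the unit circle and representatives with sum zero *)

Section Angles.
Variable R : realType.
Implicit Types (t a b : R) (s r : seq R).

Definition expi t : R[i] := Complex (cos t) (sin t).

Local Notation tau := (pi *+ 2 : R).

Lemma tau_gt0 : 0 < tau.
Proof. by rewrite pmulrn_lgt0 // pi_gt0. Qed.

Lemma expi0 : expi 0 = 1.
Proof. by rewrite /expi cos0 sin0. Qed.

Lemma expiD a b : expi (a + b) = expi a * expi b.
Proof.
by apply/eqP; rewrite eq_complex /= cosD sinD eqxx /= addrC (mulrC (sin a)) eqxx.
Qed.

Lemma expi_sum s : expi (\sum_(t <- s) t) = \prod_(t <- s) expi t.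
Proof.
by elim: s => [|t s IHs]; rewrite ?big_nil ?expi0 // !big_cons expiD IHs.
Qed.

Lemma expi_tau (m : int) : expi (tau *~ m) = 1.
Proof.
have expi_nat (k : nat) : expi (tau *+ k) = 1.
  rewrite -[tau *+ k]add0r /expi.
  by rewrite (periodicn (@cosD2pi R)) (periodicn (@sinD2pi R)) cos0 sin0.
case: m => k; first by rewrite -pmulrn.
rewrite NegzE mulrNz -pmulrn.
rewrite -[LHS]mulr1 -[X in _ * X](expi_nat k.+1) -expiD.
by rewrite addNr expi0.
Qed.

Lemma norm_expi t : `|expi t| = 1.
Proof. by rewrite normc_def /= cos2Dsin2 sqrtr1. Qed.

Lemma expi_eq1_small t : 0 <= t < tau -> expi t = 1 -> t = 0.
Proof.
move=> /andP[t0 tT] [ct st]; have pi0 := @pi_gt0 R.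
have [tpi|pit] := leP t pi.
  by apply: cos_inj; rewrite ?in_itv /= ?t0 ?lexx ?(ltW pi0) // cos0.
(* Past [pi], reflecting to [tau - t] returns to the interval where [cos] is injective; this forces
   [t = tau], which is excluded. *)
have : tau - t = 0.
  apply: cos_inj; rewrite ?in_itv /= ?lexx ?(ltW pi0) //.
  - by apply/andP; split; rewrite mulr2n in tT *; lra.
  by rewrite cosB cos2pi sin2pi mul0r addr0 mul1r cos0.
by move/eqP; rewrite subr_eq0 => /eqP tE; rewrite tE ltxx in tT.
Qed.

Lemma expi_eq1 t : expi t = 1 -> exists m : int, t = tau *~ m.
Proof.
(* Removing this multiple leaves a remainder in [[0, tau)], where [expi_eq1_small] applies. *)
move=> et; set m := Num.floor (t / tau); exists m; apply/eqP.
rewrite -subr_eq0; apply/eqP/expi_eq1_small; last first.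
  by rewrite -mulrNz expiD et expi_tau mulr1.
have /andP[lem ltm] := floor_itv (t / tau).
rewrite subr_ge0 ltrBlDl -[X in _ && (_ < _ + X)]mulr1z -mulrzDr.
by rewrite -!(mulrzr tau) !(mulrC tau) -ler_pdivlMr ?tau_gt0 // lem
  -ltr_pdivrMr ?tau_gt0 // ltm.
Qed.

Lemma expi_eq a b : expi a = expi b -> exists m : int, a = b + tau *~ m.
Proof.
move=> eab; have [|m abm] := @expi_eq1 (a - b).
  by rewrite expiD eab -expiD subrr expi0.
by exists m; rewrite -abm addrCA subrr addr0.
Qed.

Lemma expi_onto (z : R[i]) : `|z| = 1 -> exists2 t, 0 <= t < tau & expi t = z.
Proof.
case: z => a b; rewrite normc_def /= => -[] ab1.
have pi0 := @pi_gt0 R.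
have {}ab1 : a ^+ 2 + b ^+ 2 = 1.
  by rewrite -[LHS]sqr_sqrtr ?ab1 ?expr1n // addr_ge0 ?sqr_ge0.
have a1 : -1 <= a <= 1.
  by rewrite -ler_norml -[X in _ <= X]normr1 -ler_sqr ?nnegrE //
    -normrX -normrX expr1n normr1 ger0_norm ?sqr_ge0 // -ab1 lerDl sqr_ge0.
have sE : sin (acos a) = `|b|.
  by rewrite sin_acos // -ab1 addrC addKr sqrtr_sqr.
have cE : cos (acos a) = a by rewrite acosK // in_itv.
have t0 := acos_ge0 a1; have tpi := acos_lepi a1.
have [b0|b0] := leP 0 b.
  exists (acos a); first by rewrite t0 mulr2n /=; lra.
  by rewrite /expi cE sE ger0_norm.
(* For [b < 0], reflection keeps the cosine and flips the sine. It stays strictly below [tau]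
   because [acos a = 0] would force [b = 0]. *)
exists (tau - acos a).
  have : acos a != 0.
    apply/eqP => aE; move/eqP: sE.
    by rewrite aE sin0 eq_sym normr_eq0 (lt_eqF b0).
  by rewrite mulr2n; move: t0; rewrite le_eqVlt eq_sym => /orP[->|] //; lra.
rewrite /expi cosB sinB cos2pi sin2pi !mul0r !mul1r addr0 add0r cE sE.
by rewrite ltr0_norm // opprK.
Qed.

(* If one shift [m i] is positive then another one is negative, and the window
   forces [m i = 1], [m j = -1] and [a j = a i + T]: the shifted multiset is
   obtained by swapping copies of the two endpoints of the window. *)
Lemma sum_shift_in_window (N : nat) (T : R) (a b : 'I_N -> R) (m : 'I_N -> int)
    (h : R -> int) : 0 < T ->
    (forall i, b i = a i + T *~ m i) ->
    (forall i j, a i - a j <= T) -> (forall i j, b i - b j <= T) ->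
    \sum_i a i = \sum_i b i ->
  \sum_i h (a i) = \sum_i h (b i).
Proof.
move=> T0 bE aT bT sab.
have m0 : \sum_i m i = 0.
  have : T *~ (\sum_i m i) = 0.
    apply: (addrI (\sum_i a i)); rewrite addr0 {2}sab.
    under [RHS]eq_bigr do rewrite bE.
    rewrite big_split /=; congr (_ + _).
    by apply: (big_morph (fun k : int => T *~ k)) => [k l|]; rewrite ?mulrzDr.
  by move/eqP; rewrite mulrz_eq0 (gt_eqF T0) orbF => /eqP.
have swap i j : 0 < m i -> m j < 0 ->
    [/\ m i = 1, m j = -1 & a j = a i + T].
  move=> mi mj; have := aT j i; have := bT i j; rewrite !bE => bij aji.
  have mij : (2 <= m i - m j)%R by lia.
  have Tmij : T *~ 2 <= T *~ (m i - m j) by rewrite ler_pMz2l.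
  have T2 : T *~ 2 = T + T by rewrite -[2]/(Posz 2) -pmulrn mulr2n.
  move: (Tmij); rewrite mulrzBr T2 => Tmij2.
  have aE : a j = a i + T by lra.
  have mE : m i - m j = 2.
    apply/eqP; rewrite eq_le mij andbT -(ler_pMz2l T0) mulrzBr.
    by rewrite T2; lra.
  by split => //; lia.
suff [c hc] : exists c : int, forall i, h (b i) - h (a i) = m i * c.
  apply/eqP; rewrite eq_sym -subr_eq0 -sumrB.
  by under eq_bigr do rewrite hc; rewrite -mulr_suml m0 mul0r.
have [[i0 mi0]|mle0] := pselect (exists i, 0 < m i); last first.
  have m00 i : m i = 0.
    apply/eqP; rewrite -oppr_eq0; apply/eqP.
    apply: (@psumr_eq0P _ _ predT (fun i => - m i)) => //.
      by move=> j _; rewrite oppr_ge0 leNgt; apply/negP => mj; apply: mle0; exists j.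
    by rewrite sumrN m0 oppr0.
  by exists 0 => i; rewrite bE m00 mulr0z addr0 subrr mul0r.
have [j0 mj0] : exists j, m j < 0.
  apply: contrapT => mge0.
  have := @psumr_eq0P _ _ predT m; move/(_ _ m0 i0 isT) => mi00.
  rewrite mi00 ?ltxx // in mi0; move=> j _.
  by rewrite leNgt; apply/negP => mj; apply: mge0; exists j.
exists (h (a i0 + T) - h (a i0)) => i; rewrite bE.
have [mi|mi|->] := ltgtP (m i) 0; last by rewrite mulr0z addr0 subrr mul0r.
- have [_ -> ->] := swap i0 i mi0 mi.
  by rewrite mulrNz mulr1z addrK mulN1r opprB.
- have [-> _ aj] := swap i j0 mi mj0; have [_ _ aj'] := swap i0 j0 mi0 mj0.
  have -> : a i = a i0 by apply: (addIr T); rewrite -aj -aj'.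
  by rewrite mulr1z mul1r.
Qed.

(** The bound is not strict: copies of one root may sit at both ends of the window, exactly [tau]
    apart. *)
Definition in_window s := forall a b, a \in s -> b \in s -> a - b <= tau.

(** Once entries with equal image are matched, they differ by multiples of [tau]. Then
    [sum_shift_in_window], with [h] the indicator of an arbitrary predicate, equates all counts. *)
Lemma expi_perm_inj s s' : in_window s -> in_window s' ->
    \sum_(t <- s) t = \sum_(t <- s') t ->
    perm_eq (map expi s) (map expi s') -> perm_eq s s'.
Proof.
move=> ws ws' ss' /(perm_iotaP (expi 0)) [I]; rewrite size_map => pI sE.
pose r := map (nth 0 s') I.
have pr : perm_eq r s' by rewrite -[X in perm_eq _ X](mkseq_nth 0) perm_map.
have szr : size s = size r by rewrite size_map -(size_map expi) sE size_map.
rewrite -(permPr pr); have sr i : (i < size s)%N -> expi (nth 0 r i) = expi (nth 0 s i).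
  move=> ii; rewrite -[RHS](nth_map 0 (expi 0)) // sE.
  have iI : (i < size I)%N by rewrite -(size_map (nth 0 s')) -szr.
  rewrite !(nth_map 0%N) //.
  by rewrite (nth_map 0) //; move: (mem_nth 0%N iI); rewrite (perm_mem pI) mem_iota.
have /choice[m mE] (i : 'I_(size s)) :
    exists m : int, nth 0 r i = nth 0 s i + tau *~ m by exact/expi_eq/sr.
apply/permP => q.
have cE u : (count q u)%:R = \sum_(t <- u) (if q t then 1%N else 0%N)%:R :> int.
  by rewrite -natr_sum -big_mkcond sum1_count.
apply/eqP; rewrite -(eqr_nat int) !cE; apply/eqP.
rewrite [LHS](big_nth 0) [RHS](big_nth 0) -szr !big_mkord.
apply: (sum_shift_in_window (fun v => (if q v then 1 else 0)%:R) tau_gt0 mE).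
- by move=> i j; apply: ws; exact: mem_nth.
- by move=> i j; apply: ws'; rewrite -(perm_mem pr) mem_nth // -szr.
- move: ss'; rewrite -(perm_big _ pr) /=.
  by rewrite [LHS](big_nth 0) [RHS](big_nth 0) -szr !big_mkord.
Qed.

(** The angles add up to [tau] times some [M] between 0 and [size r]. Lowering the [M] largest ones
    by [tau] brings the sum to 0 without changing any exponential. *)
Lemma sum0_representatives r : (forall t, t \in r -> 0 <= t < tau) ->
    \prod_(t <- r) expi t = 1 ->
  exists s, [/\ sorted <=%O s, in_window s, \sum_(t <- s) t = 0,
    size s = size r & perm_eq (map expi s) (map expi r)].
Proof.
move=> rT; rewrite -expi_sum => /expi_eq1[M rM].
pose th := sort <=%O r.
have pth : perm_eq th r by exact/permPl/perm_sort.
have thT t : t \in th -> 0 <= t < tau by rewrite (perm_mem pth); exact: rT.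
have sth : sorted <=%O th by exact: sort_le_sorted.
have M0 : 0 <= M.
  have : 0 <= tau *~ M.
    by rewrite -rM big_seq; apply: sumr_ge0 => t /rT/andP[].
  by rewrite pmulrz_rge0 // tau_gt0.
case: M M0 rM => // M _; rewrite -pmulrn => rM.
have Mr : (M <= size r)%N.
  have : tau *+ M <= tau *+ size r.
    rewrite -rM -[X in _ *+ X]count_predT -iter_addr_0 -big_const_seq.
    by rewrite !big_seq; apply: ler_sum => t /rT/andP[_ /ltW].
  by rewrite ler_pMn2l // tau_gt0.
pose k := (size r - M)%N; have szth : size th = size r by exact: perm_size.
pose hi := drop k th; pose lo := take k th.
have szhi : size hi = M by rewrite size_drop szth subKn.
have lohi : lo ++ hi = th by exact: cat_take_drop.
have := sth; rewrite -lohi (sorted_pairwise le_trans) pairwise_cat.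
case/and3P=> /allrelP lh plo phi.
have hiT t : t \in hi -> 0 <= t < tau by move=> /mem_drop/thT.
have loT t : t \in lo -> 0 <= t < tau by move=> /mem_take/thT.
(* The lowered angles are negative, so they precede [lo] in the order. *)
exists (map (fun t => t - tau) hi ++ lo); split.
- rewrite (sorted_pairwise le_trans) pairwise_cat plo pairwise_map andbT.
  apply/andP; split; last by apply: sub_pairwise phi => x y /=; rewrite lerD2r.
  apply/allrelP => _ b /mapP[a /hiT/andP[_ aT] ->] /loT/andP[b0 _].
  by rewrite (le_trans _ b0) // subr_le0 ltW.
- move=> a b; rewrite !mem_cat.
  move=> /orP[/mapP[{}a ah ->]|al] /orP[/mapP[{}b bh ->]|bl].
  + by move: (hiT _ ah) (hiT _ bh) => /andP[? ?] /andP[? ?]; lra.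
  + by move: (hiT _ ah) (loT _ bl) => /andP[? ?] /andP[? ?]; lra.
  (* Here [a - (b - tau) <= tau] amounts to [a <= b], which comes from sorting. *)
  + by move: (lh _ _ al bh); lra.
  + by move: (loT _ al) (loT _ bl) => /andP[? ?] /andP[? ?]; lra.
- rewrite big_cat big_map sumrB /= big_const_seq count_predT szhi.
  rewrite iter_addr_0 -addrA addrC -addrA -big_cat lohi (perm_big _ pth) /=.
  by rewrite rM addNr.
- by rewrite -szth -lohi !size_cat size_map addnC.
rewrite map_cat -map_comp.
have -> : map (expi \o (fun t => t - tau)) hi = map expi hi.
  by apply: eq_map => t /=; rewrite -[tau]mulr1z -mulrNz expiD expi_tau mulr1.
by rewrite perm_catC -map_cat lohi; exact: perm_map.
Qed.

End Angles.

(** * Polynomials with prescribed roots on the unit circle *)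

Section CircularPolynomials.
Variable R : realType.
Implicit Types (s : seq R) (p : {poly R[i]}).

(** With the minus sign, the constant coefficient is [expi] of the sum of the angles, whatever the
    parity of the degree. *)
Definition circ_poly s : {poly R[i]} := \prod_(t <- s) ('X - (- expi t)%:P).

Lemma coef_mul_lin (c : R[i]) p k :
  (('X - (- c)%:P) * p)`_k = (if k == 0%N then 0 else p`_k.-1) + c * p`_k.
Proof. by rewrite polyCN opprK mulrDl coefD mulrC coefMX coefCM. Qed.

Lemma circ_poly_cons t s :
  circ_poly (t :: s) = ('X - (- expi t)%:P) * circ_poly s.
Proof. by rewrite /circ_poly big_cons. Qed.

Lemma size_circ_poly s : size (circ_poly s) = (size s).+1.
Proof. exact: size_prod_XsubC. Qed.

Lemma lead_circ_poly s : (circ_poly s)`_(size s) = 1.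
Proof.
have /monicP := monic_prod_XsubC s predT (fun t => - expi t).
by rewrite lead_coefE size_circ_poly.
Qed.

(** Each linear factor contributes a shifted and a scaled copy of the coefficients; conjugate
    reversal exchanges the two, up to the factor [expi t]. When the angles sum to 0, the polynomial
    is conjugate-reciprocal. *)
Lemma circ_poly_conj s i j : (i + j = size s)%N ->
  (circ_poly s)`_i = expi (\sum_(t <- s) t) * ((circ_poly s)`_j)^*%C.
Proof.
elim: s i j => [|t s IHs] i j.
  move=> /eqP; rewrite addn_eq0 => /andP[/eqP-> /eqP->].
  by rewrite /circ_poly !big_nil expi0 mul1r coef1 conjc1.
rewrite circ_poly_cons big_cons expiD => ij.
have tt : expi t * (expi t)^*%C = 1.
  by rewrite -sqr_normc norm_expi expr1n.
(* When [i] or [j] is 0, the other index exceeds the degree of the tail, so the corresponding terms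
   vanish on both sides. *)
have over k : (size s < k)%N -> (circ_poly s)`_k = 0.
  by move=> sk; rewrite nth_default // size_circ_poly.
rewrite !coef_mul_lin rmorphD rmorphM /= mulrDr.
rewrite [X in _ = _ + X]mulrACA tt mul1r [RHS]addrC; congr (_ + _).
  case: eqP ij => [->|/eqP i0 ij].
    by rewrite add0n => ->; rewrite over ?conjc0 ?mulr0.
  by apply: IHs; move: ij i0 => /=; lia.
rewrite -mulrA; congr (_ * _).
case: eqP ij => [->|/eqP j0 ij]; last by apply: IHs; move: ij j0 => /=; lia.
by rewrite addn0 conjc0 mulr0 => ->; rewrite over.
Qed.

(** Unique factorisation gives the exponentials up to order, [expi_perm_inj] lifts this to the
    angles, and sorting fixes the order. *)
Lemma circ_poly_inj s s' :
    sorted <=%O s -> sorted <=%O s' -> in_window s -> in_window s' ->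
    \sum_(t <- s) t = \sum_(t <- s') t ->
  circ_poly s = circ_poly s' -> s = s'.
Proof.
move=> os os' ws ws' ss' eqp; apply: le_sorted_eq => //.
apply: expi_perm_inj => //.
have /prod_XsubC_eq : \prod_(z <- [seq - expi t | t <- s]) ('X - z%:P) =
    \prod_(z <- [seq - expi t | t <- s']) ('X - z%:P) by rewrite !big_map.
move/(perm_map (@GRing.opp R[i])); rewrite -!map_comp.
by under eq_map do rewrite /= opprK; under [X in perm_eq _ X]eq_map do rewrite /= opprK.
Qed.

End CircularPolynomials.

(** * Real coordinates of conjugate-reciprocal polynomials *)

Lemma scaled_rectD (R : rcfType) (c x y : R) :
  c%:C%C * (x%:C%C + 'i%C * y%:C%C) = Complex (c * x) (c * y).
Proof.
by apply/eqP; rewrite eq_complex /=; apply/andP; split; apply/eqP; ring.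
Qed.

Lemma scaled_rectB (R : rcfType) (c x y : R) :
  c%:C%C * (x%:C%C - 'i%C * y%:C%C) = Complex (c * x) (- (c * y)).
Proof.
by apply/eqP; rewrite eq_complex /=; apply/andP; split; apply/eqP; ring.
Qed.

Section Coordinates.
Variables (R : realType) (N : nat).
Implicit Types (p : {poly R[i]}) (a : 'rV[R]_(N.-1)).

Lemma acoefE a k (hk : (k < N.-1)%N) : acoef a k.+1 = a 0 (Ordinal hk).
Proof. by rewrite /acoef /= insubT. Qed.

Lemma acoef_inj a b :
  (forall j, (0 < j < N)%N -> acoef a j = acoef b j) -> a = b.
Proof.
move=> ab; apply/rowP => -[k hk]; rewrite -!acoefE.
by apply: ab; move: hk; case: (N) => //= n; rewrite ltnS.
Qed.

(* Inverts [ccoef] on conjugate-reciprocal polynomials: [c_j] is the coefficient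
   of ['X^(N - j)], and [p`_j] that of [c_(N - j)]. *)
Definition real_coord p (j : nat) : R :=
  if (j.*2 < N)%N then Num.sqrt 2 * complex.Re p`_(N - j)
  else if j.*2 == N then complex.Re p`_j else Num.sqrt 2 * complex.Im p`_j.

Definition coords p : 'rV[R]_(N.-1) := \row_k real_coord p k.+1.

Lemma acoef_coords p j : (0 < j < N)%N -> acoef (coords p) j = real_coord p j.
Proof.
case: j => // j /= jN; have hj : (j < N.-1)%N by case: (N) jN.
by rewrite acoefE mxE.
Qed.

Lemma sqrt2_half : Num.sqrt 2 / 2 * Num.sqrt 2 = 1 :> R.
Proof. by rewrite mulrAC -expr2 sqr_sqrtr // divff // pnatr_eq0. Qed.

Lemma coef_apoly_mid a j : (0 < j < N)%N -> (apoly a)`_j = ccoef a (N - j).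
Proof.
move=> /andP[j0 jN]; rewrite /apoly !coefD coefXn coef1 coef_sum.
rewrite (ltn_eqF jN) (gtn_eqF j0) add0r addr0.
under eq_bigr do rewrite coefCM coefXn.
rewrite (bigD1_seq (N - j)%N) ?iota_uniq //=; last by rewrite mem_index_iota; lia.
rewrite subKn ?(ltnW jN) // eqxx mulr1 big_seq_cond big1 ?addr0 // => n.
rewrite mem_index_iota => /andP[nN nj].
by rewrite (_ : (j == N - n)%N = false) ?mulr0 //; apply/negbTE/eqP => jE; lia.
Qed.

Lemma coef_apoly0 a : (0 < N)%N -> (apoly a)`_0 = 1.
Proof.
move=> N0; rewrite /apoly !coefD coefXn coef1 coef_sum (ltn_eqF N0) add0r.
rewrite big_seq big1 ?add0r // => n; rewrite mem_index_iota => nN.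
by rewrite coefCM coefXn (_ : (0 == N - n)%N = false) ?mulr0 //; lia.
Qed.

Lemma coef_apolyN a : (0 < N)%N -> (apoly a)`_N = 1.
Proof.
move=> N0; rewrite /apoly !coefD coefXn coef1 coef_sum (gtn_eqF N0) addr0 eqxx.
rewrite big_seq big1 ?addr0 // => n; rewrite mem_index_iota => nN.
by rewrite coefCM coefXn (_ : (N == N - n)%N = false) ?mulr0 //; lia.
Qed.

Lemma size_apoly a : (0 < N)%N -> size (apoly a) = N.+1.
Proof.
move=> N0; apply/eqP; rewrite eqn_leq; apply/andP; split; last first.
  by rewrite ltnNge; apply/negP => /(nth_default 0)/eqP; rewrite coef_apolyN // oner_eq0.
apply/leq_sizeP => j jN; rewrite /apoly !coefD coefXn coef1 coef_sum.
rewrite (gtn_eqF jN) (_ : (j == 0)%N = false) ?add0r ?addr0; last by lia.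
rewrite big_seq big1 // => n; rewrite mem_index_iota => nN.
by rewrite coefCM coefXn (_ : (j == N - n)%N = false) ?mulr0 //; lia.
Qed.

Lemma apolyK a : coords (apoly a) = a.
Proof.
apply: acoef_inj => j jN; have jN' := jN; case/andP: jN' => j0 jN'.
rewrite acoef_coords // /real_coord.
have s2 (x : R) : Num.sqrt 2 * (Num.sqrt 2 / 2 * x) = x.
  by rewrite mulrA (mulrC (Num.sqrt 2)) sqrt2_half mul1r.
case: ltnP => [j2|j2].
  rewrite coef_apoly_mid ?subKn ?(ltnW jN') //; last by lia.
  by rewrite /ccoef j2 scaled_rectD s2.
have njE : (N - j).*2 = (N + N - j.*2)%N by lia.
case: eqP => j2'; rewrite coef_apoly_mid //.
  by rewrite /ccoef (_ : (N - j) = j)%N ?j2' ?ltnn ?eqxx //; lia.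
(* Now [N - j] lies below the middle, so its coefficient carries [acoef a j] as imaginary part. *)
rewrite /ccoef ifT; last by lia.
by rewrite subKn ?(ltnW jN') // scaled_rectD s2.
Qed.

(** [coords] reads only coefficients of index at least [N / 2]; the conjugation hypothesis
    determines the lower ones and makes a middle one real. *)
Lemma coordsK p : (0 < N)%N -> size p = N.+1 -> p`_N = 1 ->
    (forall i j, (i + j = N)%N -> p`_i = (p`_j)^*%C) ->
  apoly (coords p) = p.
Proof.
move=> N0 szp pN pconj; apply/polyP => j.
have [jN|Nj] := ltnP N j; first by rewrite !nth_default ?size_apoly ?szp.
have [->|j0] := posnP j.
  by rewrite coef_apoly0 // (pconj 0%N N) // pN conjc1.
have [->|jN] := eqVneq j N; first by rewrite coef_apolyN.
have {Nj} jN : (j < N)%N by rewrite ltn_neqAle jN.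
have s2 (x : R) : Num.sqrt 2 / 2 * (Num.sqrt 2 * x) = x.
  by rewrite mulrA sqrt2_half mul1r.
rewrite coef_apoly_mid ?j0 //; have [i jE] : exists i, j = (N - i)%N /\ (0 < i < N)%N.
  by exists (N - j)%N; lia.
case: jE => jE iN; rewrite {}jE in j0 jN *; case/andP: iN => i0 iN.
rewrite subKn ?(ltnW iN) // /ccoef !acoef_coords ?i0 ?j0 // /real_coord.
case: ltnP => [i2|i2].
  rewrite ifF; last by lia.
  rewrite ifF; last by lia.
  by rewrite scaled_rectD !s2; case: (p`_(N - i)).
case: eqP => i2'.
  have iE : (N - i)%N = i by lia.
  have : p`_i = (p`_i)^*%C by apply: pconj; lia.
  rewrite iE; case: (p`_i) => x y [] /= /eqP.
  by rewrite -addr_eq0 -mulr2n mulrn_eq0 /= => /eqP->.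
rewrite ifT; last by lia.
rewrite subKn ?(ltnW iN) // (pconj (N - i)%N i); last by lia.
by rewrite scaled_rectB !s2; case: (p`_i).
Qed.

(** The polynomial splits over [R[i]] with roots of modulus 1, and its constant coefficient 1 is
    what [sum0_representatives] requires of the angles. *)
Lemma W_circ_poly a : (0 < N)%N -> W a -> exists s,
  [/\ sorted <=%O s, in_window s, \sum_(t <- s) t = 0, size s = N
    & apoly a = circ_poly s].
Proof.
move=> N0 Wa; have [r] := closed_field_poly_normal (apoly a).
rewrite lead_coefE size_apoly // coef_apolyN // scale1r => rE.
have r1 z : z \in r -> `|z| = 1.
  by move=> zr; apply: Wa; rewrite rE root_prod_XsubC.
have szr : size r = N.
  by have := size_apoly a N0; rewrite rE size_prod_XsubC => -[].
(* [f z] is an angle of [- z], with default 0 off the unit circle. *)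
have /choice[f fP] (z : R[i]) :
    exists t, `|z| = 1 -> 0 <= t < pi *+ 2 /\ expi t = - z.
  have [z1|] := pselect (`|z| = 1); last by exists 0.
  have := @expi_onto R (- z); rewrite normrN => /(_ z1)[t tT tE].
  by exists t.
have fr : map (fun z => - expi (f z)) r = r.
  rewrite -[RHS]map_id; apply/eq_in_map => z /r1/fP[_ ->]; exact: opprK.
have [||s [os ws s0 szs ps]] := @sum0_representatives R (map f r).
- by move=> _ /mapP[z /r1/fP[fz _] ->].
(* The value at 0 is the product of the negated roots, that is, of the chosen exponentials. *)
- rewrite -[RHS](coef_apoly0 a N0) -horner_coef0 rE horner_prod big_map.
  rewrite [LHS]big_seq [RHS]big_seq; apply: eq_bigr => z /r1/fP[_ ->].
  by rewrite hornerXsubC sub0r.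
exists s; split => //; first by rewrite szs size_map.
rewrite rE -fr big_map /circ_poly.
rewrite -[RHS](big_map (@expi R) predT (fun z => 'X - (- z)%:P)).
by rewrite (perm_big _ ps) /= !big_map.
Qed.

Lemma apoly_coords_circ_poly s : (0 < N)%N -> size s = N ->
  \sum_(t <- s) t = 0 -> apoly (coords (circ_poly s)) = circ_poly s.
Proof.
move=> N0 szs s0; apply: coordsK => //; first by rewrite size_circ_poly szs.
  by rewrite -szs lead_circ_poly.
by move=> i j; rewrite -szs => /circ_poly_conj ->; rewrite s0 expi0 mul1r.
Qed.

Lemma W_coords_circ_poly s : (0 < N)%N -> size s = N ->
  \sum_(t <- s) t = 0 -> W (coords (circ_poly s)).
Proof.
move=> N0 szs s0 z; rewrite apoly_coords_circ_poly // /circ_poly.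
have := root_prod_XsubC (map (fun t => - expi t) s) z; rewrite big_map => ->.
by move=> /mapP[t _ ->]; rewrite normrN norm_expi.
Qed.

End Coordinates.

(** * Topological tools *)

Lemma compact_bijection_homeomorphic (T : topologicalType) (A B : set T)
    (h : T -> T) : hausdorff_space T -> compact A -> continuous h ->
    {in A &, injective h} -> h @` A = B ->
  homeomorphic_subspaces B A.
Proof.
move=> hT cA ch ih hA.
(* The inverse must be total on [T]; outside [B] the witness is [y] itself. *)
have /choice[g gP] y : exists x, B y -> A x /\ h x = y.
  have [|nBy] := pselect (B y); last by exists y.
  by rewrite -hA => -[x Ax xy]; exists x.
have ghK x : A x -> g (h x) = x.
  move=> Ax; have [|Agh hgh] := gP (h x); first by rewrite -hA; exists x.
  by apply: ih; rewrite ?inE.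
exists g, h; split; last split; last split; last split; last split.
(* Within [B], the preimage of [C] under [g] is the image by [h] of the part of [A] in [C]: it is
   compact, hence closed in a Hausdorff space. *)
- apply/continuous_closedP => C cC; apply/closed_subspaceP.
  exists (h @` (A `&` C)).
    apply: compact_closed => //; apply: continuous_compact.
      exact: continuous_subspaceT.
    exact: compact_closedI.
  apply/seteqP; split => y /=.
    by move=> [[x [Ax Cx] <-] By]; split => //; change (C (g (h x))); rewrite ghK.
  by move=> [Cgy By]; have [Agy hgy] := gP y By; split => //; exists (g y).
- exact: continuous_subspaceT.
- by move=> y /gP[].
- by move=> x Ax; rewrite -hA; exists x.
- by move=> y /gP[].
- exact: ghK.
Qed.

Lemma rV_continuous (R : realType) (T : topologicalType) n (f : T -> 'rV[R]_n) x :
  (forall j, {for x, continuous (fun t => f t 0 j)}) -> {for x, continuous f}.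
Proof.
move=> cf; apply/cvg_mx_entourageP => A eA.
apply: filter_forall => i; apply: filter_forall => j; rewrite (ord1 i).
change (\forall t \near x, (f x 0 j, f t 0 j) \in A).
have /cvg_entourageP/(_ A eA) := cf j.
change ((\forall t \near x, A (f x 0 j, f t 0 j)) ->
  \forall t \near x, (f x 0 j, f t 0 j) \in A).
by apply: filterS => t; exact: mem_set.
Qed.

Lemma sum_continuous (R : realType) (T : topologicalType) (I : Type)
    (s : seq I) (F : I -> T -> R) x : (forall i, {for x, continuous (F i)}) ->
  {for x, continuous (fun t => \sum_(i <- s) F i t)}.
Proof.
move=> cF; elim: s => [|i s IHs].
  have -> : (fun t => \sum_(i <- [::]) F i t) = cst 0.
    by apply/funext => t; rewrite big_nil.
  exact: cst_continuous.
have -> : (fun t => \sum_(k <- i :: s) F k t) =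
    (fun t => F i t + \sum_(k <- s) F k t).
  by apply/funext => t; rewrite big_cons.
by apply: cvgD; [exact: cF|exact: IHs].
Qed.

(** * Radial maps between the unit balls of two gauges *)

Section Radial.
Variables (R : realType) (V : normedModType R) (mu nu : V -> R) (C : R).
Hypotheses (mu_cts : continuous mu) (nu_cts : continuous nu).
Hypothesis muZ : forall c x, 0 <= c -> mu (c *: x) = c * mu x.
Hypothesis nuZ : forall c x, 0 <= c -> nu (c *: x) = c * nu x.
Hypotheses (C0 : 0 < C) (mu_norm : forall x, `|x| <= C * mu x).
Hypothesis nu_norm : forall x, `|x| <= C * nu x.

(** Rescales every ray so that the [mu]-ball goes to the [nu]-ball; the origin stays fixed. *)
Definition radial x := (mu x / nu x) *: x.

Lemma gauge_ge0 (g : V -> R) : (forall x, `|x| <= C * g x) -> forall x, 0 <= g x.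
Proof. by move=> gn x; rewrite -(pmulr_rge0 _ C0) (le_trans _ (gn x)). Qed.

Lemma gauge_neq0 (g : V -> R) : (forall x, `|x| <= C * g x) ->
  forall x, x != 0 -> g x != 0.
Proof.
move=> gn x; apply: contra => /eqP gx.
by rewrite -normr_le0 (le_trans (gn x)) // gx mulr0.
Qed.

Lemma gauge0 (g : V -> R) : (forall c x, 0 <= c -> g (c *: x) = c * g x) ->
  g 0 = 0.
Proof. by move=> gZ; rewrite -[0 in LHS](scale0r (0 : V)) gZ // mul0r. Qed.

Lemma radial_gauge x : nu (radial x) = mu x.
Proof.
have [->|x0] := eqVneq x 0; first by rewrite /radial scaler0 !gauge0.
rewrite nuZ ?divr_ge0 ?(gauge_ge0 mu_norm) ?(gauge_ge0 nu_norm) //.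
by rewrite divfK // (gauge_neq0 nu_norm).
Qed.

Lemma radial_continuous : continuous radial.
Proof.
move=> x; have [->|x0] := eqVneq x 0; last first.
  apply: cvgZ; last exact: cvg_id.
  apply: cvgM; first exact: mu_cts.
  by apply: cvgV; [exact: (gauge_neq0 nu_norm)|exact: nu_cts].
(* At 0 the quotient need not converge; instead the norm of [radial y] is at most
   [C * nu (radial y) = C * mu y], which tends to 0. *)
rewrite /continuous_at {2}/radial scaler0; apply/cvgr0Pnorm_le => e e0.
have : mu x @[x --> (0 : V)] --> (0 : R).
  by rewrite -[X in _ --> X](gauge0 muZ); exact: mu_cts.
move/cvgr0Pnorm_le => /(_ (e / C)); rewrite divr_gt0 // => /(_ isT).
apply: filterS => y ye; rewrite (le_trans (nu_norm _)) // radial_gauge.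
rewrite mulrC -ler_pdivlMr //; apply: le_trans ye; exact: ler_norm.
Qed.

End Radial.

Lemma radialK (R : realType) (V : normedModType R) (mu nu : V -> R) (C : R) :
    (forall c x, 0 <= c -> mu (c *: x) = c * mu x) ->
    (forall c x, 0 <= c -> nu (c *: x) = c * nu x) ->
    0 < C -> (forall x, `|x| <= C * mu x) -> (forall x, `|x| <= C * nu x) ->
  cancel (radial mu nu) (radial nu mu).
Proof.
move=> muZ nuZ C0 mun nun x; have [->|x0] := eqVneq x 0.
  by rewrite /radial !scaler0.
rewrite {1}/radial (radial_gauge muZ nuZ C0 mun nun).
have mx := gauge_neq0 mun x0; have nx := gauge_neq0 nun x0.
rewrite /radial muZ ?divr_ge0 ?(gauge_ge0 C0 mun) ?(gauge_ge0 C0 nun) //.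
by rewrite scalerA -[RHS]scale1r; congr (_ *: _); field; rewrite mx nx.
Qed.

(** * The Euclidean norm and the gauge of a simplex *)

Section Gauges.
Variables (R : realType) (n : nat).
Implicit Types x : 'rV[R]_n.

Definition euclid_norm x : R := Num.sqrt (\sum_i x 0 i ^+ 2).

(** Starting the maximum at the sum makes it range over [n.+1] linear forms, one per facet of a
    simplex with 0 in its interior. *)
Definition simplex_gauge x : R := \big[Num.max/(\sum_i x 0 i)]_i (- x 0 i).

Lemma euclid_norm_continuous : continuous euclid_norm.
Proof.
move=> x; apply: continuous_comp; last exact: sqrt_continuous.
apply: sum_continuous => i; apply: continuous_comp (@exprn_continuous R 2 _).
exact: coord_continuous.
Qed.

Lemma euclid_normZ c x : 0 <= c -> euclid_norm (c *: x) = c * euclid_norm x.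
Proof.
move=> c0; rewrite /euclid_norm; under eq_bigr do rewrite mxE exprMn.
by rewrite -mulr_sumr sqrtrM ?sqr_ge0 // sqrtr_sqr ger0_norm.
Qed.

Lemma ler_rV_norm x (M : R) : 0 <= M -> (forall i, `|x 0 i| <= M) -> `|x| <= M.
Proof.
move=> M0 xM; rewrite [leLHS]/Num.norm /= mx_normrE; apply: bigmax_le => // -[i j] _.
by rewrite (ord1 i).
Qed.

Lemma norm_le_euclid x : `|x| <= euclid_norm x.
Proof.
apply: ler_rV_norm => [|i]; first exact: sqrtr_ge0.
rewrite -sqrtr_sqr ler_wsqrtr // (bigD1 i) //= lerDl.
by apply: sumr_ge0 => j _; exact: sqr_ge0.
Qed.

Lemma simplex_gauge_leP x (M : R) : reflect
  ((\sum_i x 0 i <= M) /\ forall i, - x 0 i <= M) (simplex_gauge x <= M).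
Proof.
apply: (iffP (bigmax_leP _ _ _ _)) => -[sM xM]; split => // i; first exact: xM.
Qed.

Lemma simplex_gaugeZ c x : 0 <= c -> simplex_gauge (c *: x) = c * simplex_gauge x.
Proof.
move=> c0; rewrite /simplex_gauge.
rewrite [RHS](big_morph ( *%R c) (fun a b => maxr_pMr a b c0) erefl) mulr_sumr.
have -> : \sum_i (c *: x) 0 i = \sum_i c * x 0 i.
  by apply: eq_bigr => i _; rewrite mxE.
by apply: eq_bigr => i _; rewrite mxE mulrN.
Qed.

Lemma simplex_gauge_continuous : continuous simplex_gauge.
Proof.
pose total x := \sum_i x 0 i; have : continuous total.
  by move=> x; apply: sum_continuous => i; exact: coord_continuous.
change (continuous total -> continuous
  (fun x => \big[Num.max/total x]_(i <- index_enum 'I_n) (- x 0 i))).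
move: total (index_enum _) => total s ct; elim: s => [|i s IHs].
  by under eq_fun do rewrite big_nil.
under eq_fun do rewrite big_cons.
move=> x; apply: (@continuous_max _ _ (fun x => - x 0 i)); last exact: IHs.
apply: (@continuous_comp _ _ _ (fun x : 'rV[R]_n => x 0 i) -%R).
  exact: coord_continuous.
exact: opp_continuous.
Qed.

(** The [n.+1] linear forms add up to 0 and each is at most the gauge. Hence the gauge is
    nonnegative, and each [x 0 i], being the sum of the other forms, is bounded too. *)
Lemma norm_le_simplex_gauge x : `|x| <= n.+1%:R * simplex_gauge x.
Proof.
set g := simplex_gauge x; have /simplex_gauge_leP[sg xg] := lexx g.
have ng : n.+1%:R * g = g + \sum_(i < n) g.
  by rewrite sumr_const card_ord -mulrS mulr_natl.
have g0 : 0 <= g.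
  rewrite -(pmulr_rge0 _ (ltr0Sn R n)) ng -[X in X <= _](subrr (\sum_i x 0 i)).
  by rewrite lerD // -sumrN ler_sum.
apply: ler_rV_norm => [|i]; first by rewrite mulr_ge0.
have nlow : g <= n.+1%:R * g by rewrite ler_peMl // ler1n.
rewrite ler_norml lerNl (le_trans (xg i)) //= ng.
have -> : x 0 i = \sum_j x 0 j + \sum_(j | j != i) - x 0 j.
  by rewrite (bigD1 i) //= sumrN addrK.
rewrite lerD //; apply: (@le_trans _ _ (\sum_(j | j != i) g)).
  by apply: ler_sum.
by rewrite [leRHS](bigD1 i) //= lerDr.
Qed.

Lemma euclid_ball_compact : compact [set x | euclid_norm x <= 1].
Proof.
apply: bounded_closed_compact.
  exists 1; split => // M M1 x /= x1.
  by rewrite (le_trans (norm_le_euclid x)) // (le_trans x1) // ltW.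
have -> : [set x | euclid_norm x <= 1] = euclid_norm @^-1` [set t | t <= 1] by [].
apply: preimage_closed; last exact: closed_le.
by move=> x _; exact: euclid_norm_continuous.
Qed.

End Gauges.

(** * From points of the simplex to sorted angles with sum zero *)

Section Phases.
Variables (R : realType) (n : nat).
Implicit Types (x y : 'rV[R]_n) (s : seq R).

Local Notation tau := (pi *+ 2 : R).

(* [x] and [- \sum_i x 0 i] are the deviations of the [n.+1] gaps from their
   mean, normalised so that the simplex is [simplex_gauge x <= 1]. *)
Definition gap x i : R := tau / n.+1%:R * (1 + x 0 i).

Definition gap_sum x (k : nat) : R := \sum_(i < n) gap x i *+ (i < k)%N.

(** The gaps determine the angles up to a common translation; subtracting the mean selects the one
    with sum 0. *)
Definition phase x k : R :=
  gap_sum x k - (\sum_(l <- iota 0 n.+1) gap_sum x l) / n.+1%:R.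

Definition phases x := [seq phase x k | k <- iota 0 n.+1].

Lemma tauN_gt0 : 0 < tau / n.+1%:R.
Proof. by rewrite divr_gt0 ?tau_gt0. Qed.

Lemma gap_sum0 x : gap_sum x 0 = 0.
Proof. by rewrite /gap_sum big1. Qed.

Lemma gap_sumS x (i : 'I_n) : gap_sum x i.+1 = gap_sum x i + gap x i.
Proof.
rewrite /gap_sum [LHS](bigD1 i) //= [X in _ = X + _](bigD1 i) //= ltnn ltnSn.
rewrite add0r addrC; congr (_ + _); apply: eq_bigr => j ji.
by rewrite ltnS leq_eqVlt val_eqE (negbTE ji).
Qed.

Lemma gap_sumT x : gap_sum x n = tau / n.+1%:R * (n%:R + \sum_i x 0 i).
Proof.
rewrite /gap_sum (eq_bigr (gap x)) => [|i _]; last by rewrite ltn_ord.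
by rewrite -mulr_sumr big_split /= sumr_const card_ord.
Qed.

Lemma size_phases x : size (phases x) = n.+1.
Proof. by rewrite size_map size_iota. Qed.

Lemma nth_phases x k : (k <= n)%N -> (phases x)`_k = phase x k.
Proof. by move=> kn; rewrite (nth_map 0%N) ?size_iota // nth_iota. Qed.

Lemma sum_phases x : \sum_(t <- phases x) t = 0.
Proof.
rewrite big_map sumrB big_const_seq count_predT size_iota iter_addr_0.
by rewrite -[X in _ - X]mulr_natr divfK ?pnatr_eq0 // subrr.
Qed.

(** The bounds on [- x 0 i] make the gaps nonnegative, giving sortedness; the bound on the sum says
    that the gaps total at most [tau], giving the window. *)
Lemma phases_in_simplex x : simplex_gauge x <= 1 ->
  sorted <=%O (phases x) /\ in_window (phases x).
Proof.
move=> /simplex_gauge_leP[sx1 x1].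
have g0 i : 0 <= gap x i.
  by apply: mulr_ge0; [exact: ltW tauN_gt0|have := x1 i; lra].
have gs_homo k l : (k <= l)%N -> gap_sum x k <= gap_sum x l.
  move=> kl; apply: ler_sum => i _; case: ltnP => [ik|_].
    by rewrite (leq_trans ik kl).
  by rewrite mulr0n mulrn_wge0.
split.
  rewrite (sorted_pairwise le_trans) pairwise_map.
  apply: (@sub_pairwise _ leq) => [k l kl|]; first by rewrite /= lerD2r gs_homo.
  by rewrite -(sorted_pairwise leq_trans) iota_sorted.
move=> _ _ /mapP[k + ->] /mapP[l _ ->]; rewrite mem_iota add0n ltnS => /= kn.
have -> : phase x k - phase x l = gap_sum x k - gap_sum x l.
  by rewrite /phase; ring.
apply: (@le_trans _ _ (gap_sum x n)).
  have := gs_homo 0%N l isT; rewrite gap_sum0; have := gs_homo k n kn; lra.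
rewrite gap_sumT mulrAC ler_pdivrMr ?ltr0n // ler_pM2l ?tau_gt0 //.
by rewrite -[n.+1]addn1 natrD lerD2l.
Qed.

Lemma phases_inj : injective phases.
Proof.
move=> x y xy; apply/rowP => i.
have xyk k : (k <= n)%N -> phase x k = phase y k.
  by move=> kn; rewrite -!nth_phases // xy.
have gE z : gap z i = phase z i.+1 - phase z i.
  by rewrite /phase gap_sumS; ring.
have : gap x i = gap y i by rewrite !gE !xyk // ltnW.
by move/(mulfI (lt0r_neq0 tauN_gt0))/addrI.
Qed.

Lemma phases_onto s : sorted <=%O s -> in_window s ->
    \sum_(t <- s) t = 0 -> size s = n.+1 ->
  exists2 x, simplex_gauge x <= 1 & phases x = s.
Proof.
move=> os ws s0 szs.
(* Obtained by solving the formula of [gap] for prescribed consecutive differences. *)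
pose x : 'rV[R]_n := \row_i (n.+1%:R / tau * (s`_i.+1 - s`_i) - 1).
have gE i : gap x i = s`_i.+1 - s`_i.
  have := @tau_gt0 R; move=> /lt0r_neq0 t0.
  rewrite /gap mxE addrCA subrr addr0 mulrA.
  by rewrite -[tau / _]invf_div mulVf ?mul1r // mulf_neq0 ?invr_eq0 ?pnatr_eq0.
have gsE k : (k <= n)%N -> gap_sum x k = s`_k - s`_0.
  elim: k => [|k IHk] kn; first by rewrite gap_sum0 subrr.
  by rewrite (gap_sumS x (Ordinal kn)) IHk ?(ltnW kn) // gE /=; ring.
exists x.
  apply/simplex_gauge_leP; split.
    have : gap_sum x n <= tau.
      by rewrite gsE //; apply: ws; apply: mem_nth; rewrite szs.
    rewrite gap_sumT mulrAC ler_pdivrMr ?ltr0n // ler_pM2l ?tau_gt0 //.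
    by rewrite -[n.+1]addn1 natrD lerD2l.
  move=> i; rewrite -subr_ge0 opprK -(pmulr_rge0 _ tauN_gt0) -/(gap x i) gE.
  rewrite subr_ge0; apply: (sorted_leq_nth le_trans le_refl) => //.
  - by rewrite inE szs ltnW // ltnS.
  - by rewrite inE szs ltnS.
apply: (@eq_from_nth _ 0) => [|k]; rewrite size_phases // ltnS => kn.
(* Since [s] has sum 0, the mean of the partial sums is minus its first entry, so subtracting it
   recovers [s]. *)
have sE : \sum_(l <- iota 0 n.+1) gap_sum x l = n.+1%:R * - s`_0.
  rewrite (eq_big_seq (fun l => s`_l - s`_0)) => [|l]; last first.
    by rewrite mem_iota add0n ltnS => /= ln; rewrite gsE.
  rewrite sumrB big_const_seq count_predT size_iota iter_addr_0 mulrN.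
  rewrite -[X in _ - X]mulr_natl.
  have -> : \sum_(l <- iota 0 n.+1) s`_l = \sum_(t <- s) t.
    by rewrite [RHS](big_nth 0) szs /index_iota subn0.
  by rewrite s0 sub0r.
by rewrite nth_phases // /phase sE gsE // mulrAC divff ?pnatr_eq0 // mul1r opprK subrK.
Qed.

Lemma phase_continuous k : continuous (phase^~ k).
Proof.
have gsc l : continuous (gap_sum^~ l).
  move=> x; apply: sum_continuous => i; case: (i < l)%N; last exact: cst_continuous.
  change {for x, continuous (fun x => gap x i)}.
  apply: continuousM; first exact: cst_continuous.
  by apply: continuousD; [exact: cst_continuous|exact: coord_continuous].
move=> x; apply: (@continuousB _ _ _ (gap_sum^~ k)); first exact: gsc.
by apply: continuousM; [apply: sum_continuous => l; exact: gsc|exact: cst_continuous].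
Qed.

End Phases.

(** * Continuity of the coefficients in the angles *)

Lemma circ_poly_continuous (R : realType) (T : topologicalType) (f : nat -> T -> R)
    (I : seq nat) x : (forall k, {for x, continuous (f k)}) -> forall j,
  {for x, continuous (fun t => complex.Re (circ_poly [seq f k t | k <- I])`_j)} /\
  {for x, continuous (fun t => complex.Im (circ_poly [seq f k t | k <- I])`_j)}.
Proof.
(* Real and imaginary parts go together, as multiplication by [expi] mixes them; the hypothesis
   covers all [j], as the recursion also uses index [j.-1]. *)
move=> cf; elim: I => [|k I IHI] j.
  by split; exact: cst_continuous.
have cfc : {for x, continuous (fun t => cos (f k t))}.
  by apply: continuous_comp; [exact: cf|exact: continuous_cos].
have cfs : {for x, continuous (fun t => sin (f k t))}.
  by apply: continuous_comp; [exact: cf|exact: continuous_sin].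
have [cr ci] := IHI j.
pose prev t := if j == 0%N then 0 else (circ_poly [seq f k t | k <- I])`_j.-1.
have [pr pi] : {for x, continuous (fun t => complex.Re (prev t))} /\
    {for x, continuous (fun t => complex.Im (prev t))}.
  by rewrite /prev; case: eqP => _; [split; exact: cst_continuous|exact: IHI].
split.
- have -> : (fun t => complex.Re (circ_poly [seq f l t | l <- k :: I])`_j) =
    (fun t => complex.Re (prev t) +
      (cos (f k t) * complex.Re (circ_poly [seq f l t | l <- I])`_j
       - sin (f k t) * complex.Im (circ_poly [seq f l t | l <- I])`_j)).
    apply/funext => t; rewrite /= circ_poly_cons coef_mul_lin -/(prev t).
    by case: (prev t) => a b; case: (_`_j).
  by apply: cvgD => //; apply: cvgB; exact: cvgM.
- have -> : (fun t => complex.Im (circ_poly [seq f l t | l <- k :: I])`_j) =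
    (fun t => complex.Im (prev t) +
      (cos (f k t) * complex.Im (circ_poly [seq f l t | l <- I])`_j
       + sin (f k t) * complex.Re (circ_poly [seq f l t | l <- I])`_j)).
    apply/funext => t; rewrite /= circ_poly_cons coef_mul_lin -/(prev t).
    by case: (prev t) => a b; case: (_`_j).
  by apply: cvgD => //; apply: cvgD; exact: cvgM.
Qed.

Lemma coords_phases_continuous (R : realType) (n : nat) :
  continuous (fun x : 'rV[R]_n => coords n.+1 (circ_poly (phases x)) : 'rV[R]_n).
Proof.
move=> x; apply: rV_continuous => k.
have c j := circ_poly_continuous (iota 0 n.+1) (fun k => @phase_continuous R n k x) j.
have -> : (fun t : 'rV[R]_n => (coords n.+1 (circ_poly (phases t)) : 'rV[R]_n) 0 k) =
    (fun t : 'rV[R]_n => real_coord n.+1 (circ_poly (phases t)) k.+1).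
  by apply/funext => t; rewrite mxE.
rewrite /real_coord; case: (k.+1.*2 < n.+1)%N.
  by apply: continuousM; [exact: cst_continuous|exact: (c _).1].
case: (k.+1.*2 == n.+1)%N; first exact: (c _).1.
by apply: continuousM; [exact: cst_continuous|exact: (c _).2].
Qed.

(** * Assembling the homeomorphism *)

Theorem theorem1 (R : realType) (N : nat) (hN : (2 <= N)%N) :
  homeomorphic_subspaces (@W R N) (@closed_unit_ball R N).
Proof.
case: N hN => [//|n] _.
pose ball_to_simplex := radial (@euclid_norm R n) (@simplex_gauge R n).
pose h (x : 'rV[R]_n) : 'rV[R]_n :=
  coords n.+1 (circ_poly (phases (ball_to_simplex x))).
have ballE : @closed_unit_ball R n.+1 = [set x : 'rV[R]_n | euclid_norm x <= 1].
  apply/funext => x; apply/propext; rewrite /closed_unit_ball /euclid_norm /=.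
  by rewrite -[X in _ <-> _ <= X]sqrtr1 ler_sqrt.
have C0 : 0 < n.+1%:R :> R by rewrite ltr0n.
(* The radial lemmas take one constant for both gauges, so the one of the simplex gauge is used here
   too. *)
have eC (x : 'rV[R]_n) : `|x| <= n.+1%:R * euclid_norm x.
  rewrite (le_trans (norm_le_euclid x)) // ler_peMl ?ler1n //; exact: sqrtr_ge0.
have sC := @norm_le_simplex_gauge R n.
have eZ := @euclid_normZ R n; have sZ := @simplex_gaugeZ R n.
have gaugeE x : simplex_gauge (ball_to_simplex x) = euclid_norm x.
  exact: radial_gauge eZ sZ C0 eC sC x.
have inj_rad : injective ball_to_simplex.
  exact: can_inj (radialK eZ sZ C0 eC sC).
rewrite ballE; apply: (@compact_bijection_homeomorphic _ _ _ h).
- exact: norm_hausdorff.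
- exact: euclid_ball_compact.
- have cr : continuous ball_to_simplex.
    apply: (radial_continuous _ _ eZ sZ C0 eC sC).
      exact: euclid_norm_continuous.
    exact: simplex_gauge_continuous.
  by move=> x; exact: (continuous_comp (cr x) (@coords_phases_continuous R n _)).
- move=> x y; rewrite !inE /= -!gaugeE => /phases_in_simplex[ox wx].
  move=> /phases_in_simplex[oy wy] hxy; apply/inj_rad/phases_inj.
  apply: circ_poly_inj => //; first by rewrite !sum_phases.
  (* [apoly] recovers the polynomials from their coordinates, since both lists of phases have sum
     0. *)
  have := congr1 (fun a => @apoly R n.+1 a) hxy.
  by rewrite !apoly_coords_circ_poly ?size_phases ?sum_phases.
- apply/seteqP; split => [_ [x /= x1 <-]|a Wa].
    by apply: W_coords_circ_poly; rewrite ?size_phases ?sum_phases.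
  have [//|s [os ws s0 szs aE]] := W_circ_poly _ Wa.
  have [y y1 yE] := phases_onto os ws s0 szs.
  (* With the gauges exchanged, this is the inverse radial map, which carries [y] back to the
     ball. *)
  have yK := radialK sZ eZ C0 sC eC y.
  exists (radial (@simplex_gauge R n) (@euclid_norm R n) y).
    by rewrite /= (radial_gauge sZ eZ C0 sC eC).
  by rewrite /h /ball_to_simplex yK yE -aE apolyK.
Qed.
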